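(* Consider two estimators $est_1$ and $est_2$ with deviations of $\varepsilon$ and $\varepsilon+\varepsilon'$, respectively ($\varepsilon,\varepsilon'>0$), from the accurate value. If the modulation step lengths of $est_1$ and $est_2$ are $\lambda s$ and $s$, respectively ($0<\lambda<1$, $s>0$), then an unbiased answer can be obtained when $$\lambda=\frac{\varepsilon}{\varepsilon+\varepsilon'}.$$
   Context: The accurate value, denoted $acc$, is the unknown real number being estimated (e.g. the exact average of a data set), and $est_1$, $est_2$ are two real-valued estimates of it. The deviation of an estimator is its distance from $acc$. The two estimators may lie on opposite sides of $acc$ or on the same side of it. Modulation is an iterative procedure carried out in rounds: in each round each estimator is moved towards the accurate value by its modulation step length, so that after $t$ rounds $est_1$ has been moved by a total of $\lambda t s$ and $est_2$ by a total of $ts$. (If $acc$ lies between the two estimators, the larger is decreased and the smaller is increased; if both are on the same side of $acc$, they are moved in the same direction.) The aim is for the two estimators to become equal, their common value being the answer. An unbiased answer (unbiased estimate) is obtained when $est_1$ and $est_2$ are both modulated to $acc$.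
   Formalization: The number t of rounds may be any nonnegative real for arbitrary s; the version with whole rounds is stated only when s divides ε+ε' a whole number of times, since otherwise whole rounds never bring both estimators exactly to the accurate value. *)

(* Defs.v *)
From mathcomp Require Import all_boot all_order all_algebra.
From mathcomp Require Import reals.

Set Implicit Arguments.
Unset Strict Implicit.
Unset Printing Implicit Defensive.

Import Order.TTheory GRing.Theory Num.Theory.
Local Open Scope ring_scope.

Definition deviation (R : realType) (acc est : R) : R := `|est - acc|.

(* The direction is fixed once and for all by the initial estimate: two
   estimates on opposite sides of acc move in opposite directions, two
   estimates on the same side move in the same direction. A move is not
   truncated at acc, so that an estimate may overshoot it. *)
Definition modulation_dir (R : realType) (acc est : R) : R :=
  Num.sg (acc - est).

Definition modulation_round (R : realType) (acc est step x : R) : R :=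
  x + modulation_dir acc est * step.

Definition modulated_rounds (R : realType) (acc est step : R) (n : nat) : R :=
  iter n (modulation_round acc est step) est.

(* Total displacement t * step for a real duration t: the linear interpolation
   of the rounds, see modulated_roundsE. The two estimates reach acc at
   t = (eps + eps') / s, which is a whole number only if s divides
   eps + eps'. *)
Definition modulated (R : realType) (acc est step t : R) : R :=
  est + modulation_dir acc est * (t * step).

Lemma modulated_roundsE (R : realType) (acc est step : R) (n : nat) :
  modulated_rounds acc est step n = modulated acc est step n%:R.
Proof.
rewrite /modulated_rounds /modulated; elim: n => [|n IHn] /=.
  by rewrite mul0r mulr0 addr0.
by rewrite IHn /modulation_round -addrA -mulrDr -natr1 mulrDl mul1r.
Qed.

(* x1 and x2 have become equal and their common value, the answer, is acc. *)
Definition unbiased_answer (R : realType) (acc x1 x2 : R) : Prop :=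
  x1 = acc /\ x2 = acc.

(* Main.v *)
(* Both estimators reach acc at the same time t = (eps + eps') / s, since
   lambda * (t * s) = eps for the given lambda. *)
Require Import Defs.
From mathcomp Require Import all_boot all_order all_algebra.
From mathcomp Require Import reals.

Import Order.TTheory GRing.Theory Num.Theory.
Local Open Scope ring_scope.

(** An estimator lands on [acc], from either side, once its total displacement equals its deviation
    ([modulated_deviation]). Over a common duration the displacements are in ratio [lambda] to 1,
    and the given [lambda] makes this the ratio of the deviations, so both arrive together. *)

Lemma modulated_deviation (R : realType) (acc est step t : R) :
  t * step = deviation acc est -> modulated acc est step t = acc.
Proof.
(* By [numEsg], sign times distance is the signed gap [acc - est]. *)
by move=> tE; rewrite /modulated /modulation_dir tE /deviation distrC -numEsg subrKC.
Qed.

Theorem theorem1 (R : realType) (acc est1 est2 eps eps' lambda s : R)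
    (heps : 0 < eps) (heps' : 0 < eps')
    (hest1 : deviation acc est1 = eps)
    (hest2 : deviation acc est2 = eps + eps')
    (hlambda : 0 < lambda < 1) (hs : 0 < s)
    (hlambdaE : lambda = eps / (eps + eps')) :
  (exists2 t : R, 0 <= t &
     unbiased_answer acc (modulated acc est1 (lambda * s) t)
                         (modulated acc est2 s t))
  /\
  (forall n : nat, n%:R * s = eps + eps' ->
     unbiased_answer acc (modulated_rounds acc est1 (lambda * s) n)
                         (modulated_rounds acc est2 s n)).
Proof.
(* Kept general in [t]: it serves both the real duration [(eps + eps') / s] and a whole number of
   rounds. *)
have unbiased t : t * s = eps + eps' ->
    unbiased_answer acc (modulated acc est1 (lambda * s) t)
                        (modulated acc est2 s t).
  move=> tsE; split; apply: modulated_deviation; last by rewrite hest2.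
  by rewrite hest1 mulrCA tsE hlambdaE divfK // gt_eqF // addr_gt0.
split; last by move=> n nsE; rewrite !modulated_roundsE; apply: unbiased.
exists ((eps + eps') / s); first by rewrite divr_ge0 ?addr_ge0 ?ltW.
by apply: unbiased; rewrite divfK // gt_eqF.
Qed.
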